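(* Suppose $K:[0,1]\times[0,1]\to[0,1]$ is (Borel measurable and) such that for every $\epsilon>0$ there exists an open set $A_\epsilon\subseteq[0,1]\times[0,1]$ with $K$ uniformly continuous on $A_\epsilon$ and, denoting $B^u_\epsilon=\{v:(u,v)\in A_\epsilon\}$, $\lambda\big((B^u_\epsilon)^c\big)\le\epsilon$ for every $u\in[0,1]$, where $\lambda$ is Lebesgue measure on $[0,1]$. For each $N\ge1$ let $$K^N\Big(\frac iN,\frac jN\Big)\sim Be\Big(K\Big(\frac iN,\frac jN\Big)\Big),\qquad i,j=1,\dots,N,$$ be independent Bernoulli random variables (the variables for all $N$ being defined on a common probability space). Then $\|K^N-K\|_\square\to0$ almost surely as $N\to\infty$.
   Context: $Be(p)$ denotes the Bernoulli distribution with parameter $p$. $K^N$ is extended to $[0,1)^2$ as the step function $K^N(u,v):=K^N\Big(\frac{\lfloor Nu+1\rfloor}N,\frac{\lfloor Nv+1\rfloor}N\Big)$. The cut norm is $$\|K^N-K\|_\square:=\sup_{S,T\in\mathcal B([0,1])}\Big|\int_{S\times T}[K^N(u,v)-K(u,v)]\,du\,dv\Big| ,$$ where $\mathcal B([0,1])$ is the Borel $\sigma$-field. *)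

(* Defs.v *)
From HB Require Import structures.
From mathcomp Require Import all_boot all_order all_algebra.
From mathcomp Require Import all_classical all_reals all_analysis.
Import Order.TTheory GRing.Theory Num.Theory.
Import numFieldTopology.Exports numFieldNormedType.Exports.
Set Implicit Arguments.
Unset Strict Implicit.
Unset Printing Implicit Defensive.
Local Open Scope classical_set_scope.
Local Open Scope ring_scope.

Definition unit_square (R : realType) : set (R * R) :=
  `[0, 1]%classic `*` `[0, 1]%classic.
Arguments unit_square : clear implicits.

(* The open sets are open relatively to the square (a subset of the square that
   is open in the plane has empty sections at u = 0 and u = 1), and
   [subspace A] is A with its induced uniform structure, to which isolated
   points are added outside A. *)
Definition unif_continuous_off_small_sections (R : realType)
    (K : R * R -> R) : Prop :=
  forall e : R, 0 < e -> exists A : set (R * R),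
    [/\ A `<=` unit_square R,
        open (A : set (subspace (unit_square R))),
        unif_continuous (K : subspace A -> R) &
        forall u : R, u \in `[0, 1] ->
          (lebesgue_measure (`[0%R, 1%R]%classic `\` [set v | A (u, v)])
             <= e%:E)%E].

Definition mutually_independent (R : realType) (d : measure_display)
    (Omega : measurableType d) (P : probability Omega R) (I : finType)
    (X : I -> {RV P >-> R}) : Prop :=
  forall (J : {set I}) (B : I -> set R),
    (forall i, i \in J -> measurable (B i)) ->
    P (\bigcap_(i in [set` J]) (X i @^-1` B i)) =
    (\prod_(i in J) P (X i @^-1` B i))%E.

(* The law on the real line of a Bernoulli variable: [bernoulli_prob p] is a
   measure on [bool], transported to {0, 1}. *)
Definition bernoulli_law (R : realType) (p : R) : set R -> \bar R :=
  pushforward (bernoulli_prob p) (fun b : bool => b%:R : R).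

(* [G i j], for 1 <= i, j <= N, is the value at (i/N, j/N). The step function
   is defined on [0, 1)^2; we extend it by 0, which only matters on a null set
   of the unit square. [Num.truncn] is the floor on nonnegative reals. *)
Definition step_kernel (R : realType) (N : nat) (G : nat -> nat -> R)
    (p : R * R) : R :=
  if (p.1 \in `[0, 1[) && (p.2 \in `[0, 1[)
  then G (Num.truncn (N%:R * p.1 + 1)) (Num.truncn (N%:R * p.2 + 1))
  else 0.

Definition cut_norm (R : realType) (W : R * R -> R) : \bar R :=
  ereal_sup [set x : \bar R | exists S T : set R,
    [/\ measurable S, measurable T, S `<=` `[0, 1], T `<=` `[0, 1] &
        x = `| \int[(lebesgue_measure \x lebesgue_measure)%E]_(p in S `*` T)
                 (W p)%:E |%E]].

(* Main.v *)
Require Import Defs.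
From HB Require Import structures.
From mathcomp Require Import all_boot all_order all_algebra.
From mathcomp Require Import all_classical all_reals all_analysis.
From mathcomp Require Import measurable_realfun ring lra.
Import Order.TTheory GRing.Theory Num.Theory.
Import numFieldTopology.Exports numFieldNormedType.Exports.
Local Open Scope classical_set_scope.
Local Open Scope ring_scope.

(** Write X for the random 0-1 array, p for its array of means K(i/N, j/N), and
step(G) for the step function of an array G.  Since step is linear, the error
splits as

  step(X) - K = step(X - p) + (step(p) - K),

a random centred part and a deterministic discretization error; the first is
small in cut norm and the second in L1, which dominates the cut norm.

Random part.  The integral of step(G) over S x T is a bilinear form in the
masses that S and T give to the grid cells, and these range over [0, 1/N].  A
bilinear form on a box is extremal at the vertices, so the integral is at most
N^-2 times the largest of the sums of G over A x B, with A and B sets of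
indices ([integral_step_kernel_le]).  This leaves 4^N rectangles, each carrying
a sum of at most N^2 independent bounded centred variables.  By Chernoff's bound
such a sum exceeds N^2 times a suitable multiple of N^(-1/2) with probability at
most 2 exp(-3N), and 4^N exp(-3N) <= 2^-N is summable, so Borel-Cantelli applies
([ae_small_rectangle_sums]).

Because the variables take two values, the joint law is a finite product
([probability_success_pattern]) and the exponential moment behind Chernoff's
bound is a finite sum that factors over the index set ([bernoulli_chernoff]).

Deterministic part.  The node sampled by step(p) at (u, v) tends to (u, v), so
step(p) tends to K at every point where K is continuous relatively to the
square.  Every point of the open sets of the hypothesis is one, and these sets,
taken for e = 1/(n+1), together cover almost all of the square by Fubini's
theorem ([regular_points_full_measure]).  Dominated convergence gives the limit
in L1 ([integral_step_kernel_grid_sample]). *)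

Set Implicit Arguments.
Unset Strict Implicit.
Unset Printing Implicit Defensive.

(** * A Chernoff bound for finite product measures *)

(** From exp(y) <= 1/(1 - y) = 1 + y + y^2/(1 - y). *)
Lemma expR_le_quadratic (R : realType) (y : R) :
  y <= 2^-1 -> expR y <= 1 + y + 2 * y ^+ 2.
Proof.
move=> y2; have e0 := expR_gt0 (- y); have := expR_ge1Dx (- y) => e1.
rewrite -[y in expR y]opprK expRN -[_^-1]mul1r ler_pdivrMr//.
have q0 : 0 <= 1 + y + 2 * y ^+ 2 by nra.
apply: le_trans (ler_wpM2l q0 e1).
have : 0 <= y ^+ 2 * (1 - 2 * y) by rewrite mulr_ge0 ?sqr_ge0//; lra.
nra.
Qed.

(** The first-order terms cancel because the variable is centred; this is a
crude form of Hoeffding's lemma. *)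
Lemma bernoulli_mgf_le (R : realType) (p s : R) :
  0 <= p <= 1 -> `|s| <= 2^-1 ->
  p * expR (s * (1 - p)) + (1 - p) * expR (s * (0 - p)) <= expR (2 * s ^+ 2).
Proof.
move=> /andP[p0 p1]; rewrite ler_norml => /andP[s1 s2].
apply: le_trans (expR_ge1Dx _).
have h1 : expR (s * (1 - p)) <= _ :=
  @expR_le_quadratic R (s * (1 - p)) ltac:(nra).
have h2 : expR (s * (0 - p)) <= _ :=
  @expR_le_quadratic R (s * (0 - p)) ltac:(nra).
apply: le_trans (lerD (ler_wpM2l p0 h1) (ler_wpM2l _ h2)) _; first lra.
have : 0 <= s ^+ 2 * (1 - p * (1 - p)) by rewrite mulr_ge0 ?sqr_ge0//; nra.
nra.
Qed.

Definition bernoulli_weight (R : realType) (I : finType) (p : I -> R)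
    (b : {ffun I -> bool}) : R :=
  \prod_i (if b i then p i else 1 - p i).

Lemma bernoulli_weight_ge0 (R : realType) (I : finType) (p : I -> R) b :
  (forall i, 0 <= p i <= 1) -> 0 <= bernoulli_weight p b.
Proof.
move=> p01; apply: prodr_ge0 => i _.
by have /andP[p0 p1] := p01 i; case: (b i) => //; rewrite subr_ge0.
Qed.

(** Markov's inequality for the exponential of the sum, whose mean factors over
the indices by distributivity.  The sign of [s] selects the tail. *)
Lemma bernoulli_chernoff (R : realType) (I : finType) (p : I -> R)
    (A : {set I}) (s t : R) :
  (forall i, 0 <= p i <= 1) -> `|s| <= 2^-1 ->
  \sum_(b : {ffun I -> bool} | t < s * \sum_(i in A) ((b i)%:R - p i))
    bernoulli_weight p b
  <= expR (2 * s ^+ 2 * #|I|%:R - t).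
Proof.
move=> p01 s2.
(* The indices outside A contribute the factor 1, still at most exp(2s^2), so
   that one bound in #|I| serves all subsets. *)
pose F (i : I) (c : bool) := (if c then p i else 1 - p i) *
  (if i \in A then expR (s * (c%:R - p i)) else 1).
have F0 i c : 0 <= F i c.
  have /andP[p0 p1] := p01 i; rewrite /F mulr_ge0//.
    by case: c => //; rewrite subr_ge0.
  by case: ifP => // _; exact: expR_ge0.
have prodF (b : {ffun I -> bool}) : \prod_i F i (b i) =
    bernoulli_weight p b * expR (s * \sum_(i in A) ((b i)%:R - p i)).
  by rewrite big_split/= mulr_sumr expR_sum [X in _ = _ * X]big_mkcond.
have -> : expR (2 * s ^+ 2 * #|I|%:R - t) =
    expR (- t) * \prod_(i : I) expR (2 * s ^+ 2).
  by rewrite prodr_const -expRM_natr -expRD addrC.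
apply: (@le_trans _ _ (expR (- t) * \prod_i \sum_c F i c)); last first.
  rewrite ler_wpM2l ?expR_ge0//; apply: ler_prod => i _.
  rewrite sumr_ge0//=.
  have /andP[p0 p1] := p01 i.
  rewrite big_bool /F/=; case: ifP => _; first exact: bernoulli_mgf_le.
  rewrite !mulr1 subrKC (le_trans _ (expR_ge1Dx _))//.
  by rewrite lerDl mulr_ge0 ?sqr_ge0.
rewrite bigA_distr_bigA mulr_sumr.
rewrite [leLHS]big_mkcond; apply: ler_sum => b _.
have w0 := bernoulli_weight_ge0 b p01.
case: ifPn => [tb|_]; last by rewrite mulr_ge0 ?expR_ge0// prodr_ge0.
rewrite prodF mulrCA -expRD -[leLHS]mulr1 ler_wpM2l//.
rewrite (le_trans _ (expR_ge1Dx _))// lerDl; lra.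
Qed.

(** Union bound over the family and over the two tails. *)
Lemma bernoulli_family_deviation (R : realType) (I L : finType) (p : I -> R)
    (A : L -> {set I}) (s t : R) :
  (forall i, 0 <= p i <= 1) -> 0 < s <= 2^-1 ->
  \sum_(b : {ffun I -> bool} |
      [exists l, t < `|\sum_(i in A l) ((b i)%:R - p i)|]) bernoulli_weight p b
  <= #|L|%:R * (2 * expR (2 * s ^+ 2 * #|I|%:R - s * t)).
Proof.
move=> p01 /andP[s0 s2].
pose f l (b : {ffun I -> bool}) := \sum_(i in A l) ((b i)%:R - p i).
apply: (@le_trans _ _ (\sum_l
    (\sum_(b | s * t < s * f l b) bernoulli_weight p b +
     \sum_(b | s * t < - s * f l b) bernoulli_weight p b))); last first.
  rewrite mulr_natl -sumr_const; apply: ler_sum => l _.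
  rewrite (mulrDl 1 1) !mul1r.
  apply: lerD; first by apply: bernoulli_chernoff; rewrite // gtr0_norm.
  by rewrite -(sqrrN s); apply: bernoulli_chernoff; rewrite // normrN gtr0_norm.
pose g b l := (if s * t < s * f l b then bernoulli_weight p b else 0) +
              (if s * t < - s * f l b then bernoulli_weight p b else 0).
rewrite [leRHS](eq_bigr (fun l => \sum_b g b l)); last first.
  by move=> l _; rewrite [RHS]big_split/= -!big_mkcond.
rewrite exchange_big/= [leLHS]big_mkcond; apply: ler_sum => b _.
have w0 := bernoulli_weight_ge0 b p01.
have g0 l : 0 <= g b l by apply: addr_ge0; case: ifP.
case: ifPn => [/existsP[l tl]|_]; last exact: sumr_ge0.
rewrite (bigD1 l)//= -[leLHS]addr0; apply: lerD; last exact: sumr_ge0.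
move: tl; rewrite /g -/(f l b) real_ltr_normr ?num_real// => /orP[tl|tl].
  by rewrite ltr_pM2l// tl lerDl; case: ifP.
by rewrite mulNr -mulrN [X in _ + X]ifT ?ltr_pM2l// lerDr; case: ifP.
Qed.

(** * The law of independent Bernoulli variables *)

(** The test X = 1 is made at every sample point, also on the null set where X
is neither 0 nor 1, so that the events below need no exceptional set. *)
Definition success_pattern (T : Type) (R : realType) (I : finType)
    (X : I -> T -> R) (w : T) : {ffun I -> bool} := [ffun i => X i w == 1].

Section bernoulli_family.
Context (R : realType) (d : measure_display) (Omega : measurableType d).
Context (P : probability Omega R) (I : finType).
Context (X : I -> {RV P >-> R}) (p : I -> R).
Hypothesis p01 : forall i, 0 <= p i <= 1.
Hypothesis X_law : forall i (B : set R), measurable B ->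
  distribution P (X i) B = bernoulli_law (p i) B.
Hypothesis X_indep : mutually_independent X.

Let B (c : bool) : set R := if c then [set 1] else ~` [set 1].

Let mB c : measurable (B c).
Proof. by case: c; [|apply: measurableC]; exact: measurable_set1. Qed.

Let pattern_eqE (b : {ffun I -> bool}) :
  [set w | success_pattern X w = b] =
  \bigcap_(i in [set` [set: I]%SET]) (X i @^-1` B (b i)).
Proof.
apply/seteqP; split => [w <- i _|w /= Xb]; rewrite /B.
  by rewrite /preimage/= ffunE; case: eqP.
apply/ffunP => i; rewrite ffunE; have /= := Xb i ltac:(by rewrite /= inE).
by rewrite /preimage /B/=; case: (b i) => /= [->|/eqP/negbTE//]; rewrite eqxx.
Qed.

Lemma measurable_success_pattern (Q : pred {ffun I -> bool}) :
  measurable [set w | Q (success_pattern X w)].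
Proof.
have -> : [set w | Q (success_pattern X w)] =
    \bigcup_(b in [set b | Q b]) [set w | success_pattern X w = b].
  apply/seteqP; split => [w Qw|w [b Qb /= ->//]].
  by exists (success_pattern X w).
apply: fin_bigcup_measurable => [|b _]; first exact: finite_finset.
rewrite pattern_eqE; apply: fin_bigcap_measurable => [|i _].
  exact: finite_finset.
by rewrite -[X in measurable X]setTI; apply: measurable_funPT.
Qed.

(** Each pattern is an intersection of events X i = 1 or X i <> 1, to which
independence applies. *)
Lemma probability_success_pattern (Q : pred {ffun I -> bool}) :
  P [set w | Q (success_pattern X w)] =
  (\sum_(b | Q b) bernoulli_weight p b)%:E.
Proof.
have -> : [set w | Q (success_pattern X w)] =
    \bigcup_(b in [set` Q]) [set w | success_pattern X w = b].
  apply/seteqP; split => [w Qw|w [b Qb /= ->//]].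
  by exists (success_pattern X w).
rewrite measure_fin_bigcup.
- rewrite -sumEFin (bigfs _ (index_enum_uniq _))/=; last first.
    by move=> b _; rewrite mem_index_enum.
  apply: eq_fsbigr => b _; rewrite pattern_eqE X_indep; last first.
    by move=> i _; exact: mB.
  rewrite -prodEFin; apply: eq_big => [i|i _]; first by rewrite inE.
  have /= := X_law i (mB (b i)); rewrite /distribution /pushforward/= => ->.
  rewrite /bernoulli_law /pushforward bernoulli_probE//= !diracE.
  rewrite /B; case: (b i).
    rewrite mem_set//= memNset/= ?mule1 ?mule0 ?adde0//.
    by move=> /esym/eqP; rewrite oner_eq0.
  rewrite memNset/= ?mem_set//= ?mule1 ?mule0 ?add0e//.
  by move=> /esym/eqP; rewrite oner_eq0.
- exact: finite_finset.
- by move=> b b' _ _ [w [/= <- <-]].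
- move=> b _; have := measurable_success_pattern (pred1 b).
  by congr measurable; apply/seteqP; split => w /= /eqP.
Qed.

End bernoulli_family.

(** The law gives mass 0 to the complement of {0, 1}. *)
Lemma bernoulli_ae_01 (R : realType) (d : measure_display)
    (Omega : measurableType d) (P : probability Omega R) (X : {RV P >-> R})
    (p : R) :
  (forall B : set R, measurable B -> distribution P X B = bernoulli_law p B) ->
  {ae P, forall w, X w = (X w == 1)%:R}.
Proof.
move=> X_law.
have m01 : measurable (~` ([set 0] `|` [set 1]) : set R).
  by apply: measurableC; apply: measurableU; exact: measurable_set1.
exists (X @^-1` (~` ([set 0] `|` [set 1]))); split.
- by rewrite -[X in measurable X]setTI; apply: measurable_funPT.
- have /= := X_law _ m01; rewrite /distribution /pushforward/= => ->.
  rewrite /bernoulli_law /pushforward -[RHS](measure0 (bernoulli_prob p)).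
  congr bernoulli_prob; apply/seteqP.
  by split => // -[] /=; apply; [right|left].
- by move=> w /= h [X0|X1]; apply: h; rewrite ?X0 ?X1 ?eqxx// eq_sym oner_eq0.
Qed.

(** * Simultaneous control of all rectangle sums *)

(** It has the form 4s with s^2 = 3/(2N): in Chernoff's bound with parameter s
and N^2 variables, the exponent 2 s^2 N^2 - s (4 s N^2) is then -3N, and exp(-3)
beats the factor 4 of the number 4^N of rectangles. *)
Definition deviation_rate (R : realType) (N : nat) : R :=
  4 * Num.sqrt (3 / (2 * N%:R)).

Lemma cvg_deviation_rate (R : realType) :
  @deviation_rate R N @[N --> \oo] --> 0.
Proof.
rewrite -[0](mulr0 4); apply: cvgMr.
rewrite -[X in _ --> X](sqrtr0 R).
apply: (continuous_cvg _ (@sqrt_continuous R 0)).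
rewrite -[X in _ --> X](mulr0 (3 / 2)).
under eq_fun do rewrite invfM mulrA.
apply: cvgMr; apply/gtr0_cvgV0; last exact: cvgr_idn.
by near=> N; rewrite ltr0n; near: N; exact: nbhs_infty_gt.
Unshelve. all: by end_near. Qed.

Lemma expR_three_ge8 (R : realType) : 8 <= expR 3 :> R.
Proof.
have -> : expR 3 = expR 1 ^+ 3 :> R by rewrite -expRM_natr mul1r.
have e2 : 2 <= expR 1 :> R by have := expR_ge1Dx (1 : R); lra.
have -> : 8 = 2 ^+ 3 :> R by ring.
by apply: lerXn2r e2; rewrite nnegrE ?expR_ge0.
Qed.

Section small_rectangle_sums.
Context (R : realType) (d : measure_display) (Omega : measurableType d).
Context (P : probability Omega R).
Context (X : forall N, 'I_N * 'I_N -> {RV P >-> R}).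
Context (p : forall N, 'I_N * 'I_N -> R).
Hypothesis p01 : forall N i, 0 <= @p N i <= 1.
Hypothesis X_law : forall N i (B : set R), measurable B ->
  distribution P (@X N i) B = bernoulli_law (@p N i) B.
Hypothesis X_indep : forall N, mutually_independent (@X N).

Let big_deviation N (b : {ffun 'I_N * 'I_N -> bool}) : bool :=
  [exists ST : {set 'I_N} * {set 'I_N}, deviation_rate R N * N%:R ^+ 2 <
     `|\sum_(ij in finset.setX ST.1 ST.2) ((b ij)%:R - p ij)|].

(** The bound is 64 / 2^N in the shape of [epsilon_trick0]; N >= 6 ensures that
the Chernoff parameter is at most 1/2. *)
Lemma bernoulli_square_deviation N : (6 <= N)%N ->
  \sum_(b | @big_deviation N b) bernoulli_weight (@p N) b <=
  128 / (2 ^ N.+1)%:R.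
Proof.
move=> N6; pose s : R := Num.sqrt (3 / (2 * N%:R)).
have N0 : 0 < N%:R :> R by rewrite ltr0n (leq_trans _ N6).
have s0 : 0 < s by rewrite sqrtr_gt0 divr_gt0// mulr_gt0.
have s2 : s <= 2^-1.
  rewrite -[leRHS]gtr0_norm ?invr_gt0// -[leRHS]sqrtr_sqr ler_wsqrtr//.
  have : 6 <= N%:R :> R by rewrite ler_nat.
  by rewrite ler_pdivrMr ?mulr_gt0//; lra.
have sE : s ^+ 2 = 3 / (2 * N%:R).
  by rewrite sqr_sqrtr// divr_ge0// mulr_ge0// ltW.
have := @bernoulli_family_deviation R _ _ (@p N)
  (fun ST => finset.setX ST.1 ST.2) s (deviation_rate R N * N%:R ^+ 2) (@p01 N).
rewrite s0 s2 => /(_ isT) /le_trans; apply.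
rewrite /deviation_rate -/s !card_prod card_ord.
have -> : 2 * s ^+ 2 * (N * N)%:R - s * (4 * s * N%:R ^+ 2) = (- 3) * N%:R.
  have -> : s * (4 * s * N%:R ^+ 2) = 4 * s ^+ 2 * N%:R ^+ 2 by ring.
  by rewrite sE natrM; field; rewrite gt_eqF.
have -> : #|{set 'I_N}| = (2 ^ N)%N.
  by rewrite -cardsT -powersetT card_powerset cardsT card_ord.
rewrite expRM_natr expRN.
have h8 : (expR 3)^-1 ^+ N <= 8^-1 ^+ N :> R.
  apply: lerXn2r; rewrite ?nnegrE ?invr_ge0 ?expR_ge0//.
  by rewrite lef_pV2 ?posrE ?expR_gt0// expR_three_ge8.
apply: (@le_trans _ _ ((2 ^ N * 2 ^ N)%:R * (2 * 8^-1 ^+ N))).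
  by rewrite ler_wpM2l// ler_wpM2l.
have -> : (2 ^ N * 2 ^ N)%:R * (2 * 8^-1 ^+ N) = 2 * 2^-1 ^+ N :> R.
  by rewrite natrM natrX mulrCA -!exprMn; congr (_ * _ ^+ N); field.
have -> : 128 / (2 ^ N.+1)%:R = 64 * 2^-1 ^+ N :> R.
  by rewrite natrX exprS exprVn; field; rewrite expf_neq0.
by rewrite ler_wpM2r ?exprn_ge0// ler_nat.
Qed.

(** Borel-Cantelli for the events that some rectangle sum is large. *)
Lemma ae_small_rectangle_sums :
  {ae P, forall w, \forall N \near \oo, forall S T : {set 'I_N},
    `|\sum_(ij in finset.setX S T) (X ij w - p ij)| <=
    deviation_rate R N * N%:R ^+ 2}.
Proof.
pose F N := [set w | @big_deviation N (success_pattern (@X N) w)].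
have mF N : measurable (F N) by exact: measurable_success_pattern.
have PF N : (P (F N) <= (128 / (2 ^ N.+1)%:R)%:E)%E.
  have [N6|N6] := leqP 6 N.
    rewrite /F (probability_success_pattern (@p01 N) (@X_law N) (@X_indep N)).
    by rewrite lee_fin bernoulli_square_deviation.
  (* The constant 128 makes the bound trivial for the remaining N <= 5. *)
  apply: le_trans (probability_le1 P (mF N)) _.
  rewrite lee_fin ler_pdivlMr ?ltr0n ?expn_gt0// mul1r ler_nat.
  by apply: (@leq_trans (2 ^ 6)) => //; rewrite leq_exp2l.
have F0 : P (lim_sup_set F) = 0%E.
  apply: lim_sup_set_cvg0 => //.
  apply: (@le_lt_trans _ _ 128%:E); last by rewrite ltry.
  apply: le_trans (epsilon_trick0 xpredT _) => //.
  by apply: lee_nneseries => // N _; exact: PF.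
have ae01 : {ae P, forall w N (i : 'I_N * 'I_N), X i w = (X i w == 1)%:R}.
  apply: ae_foralln => N; apply: filter_forall => i.
  exact: bernoulli_ae_01 (X_law i).
have aeF : {ae P, forall w, ~ lim_sup_set F w}.
  exists (lim_sup_set F); split => //.
    by apply: bigcap_measurable => // n _; apply: bigcup_measurable.
  by move=> w /= /contrapT.
apply: filterS2 ae01 aeF => w X01 /existsNP[n /not_implyP[_ Fn]].
exists n => // N /= nN S T; rewrite leNgt; apply/negP => dev; apply: Fn.
exists N => //; rewrite /F/=; apply/existsP; exists (S, T); move: dev.
under eq_bigr do rewrite X01.
by under [in X in _ -> X]eq_bigr do rewrite ffunE.
Qed.
End small_rectangle_sums.

(** * Integrals of step kernels over rectangles *)

(** A linear form on the cube [0, h]^I is maximal at a vertex: keep the indices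
with a positive coefficient. *)
Lemma weighted_sum_le (R : realType) (I : finType) (a c : I -> R) (h M : R) :
  0 <= h -> (forall i, 0 <= a i <= h) ->
  (forall S : {set I}, `|\sum_(i in S) c i| <= M) ->
  `|\sum_i a i * c i| <= h * M.
Proof.
move=> h0 ah.
have upper (e : I -> R) : (forall S : {set I}, \sum_(i in S) e i <= M) ->
    \sum_i a i * e i <= h * M.
  move=> eM; apply: le_trans (ler_wpM2l h0 (eM [set i | 0 < e i]%SET)).
  rewrite mulr_sumr [leRHS]big_mkcond; apply: ler_sum => i _.
  have /andP[a0 aih] := ah i; rewrite inE; case: ltP => [e0|e0].
    by rewrite ler_wpM2r// ltW.
  by rewrite mulr_ge0_le0.
move=> cM; rewrite ler_norml -lerN2 opprK andbC; apply/andP; split.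
  by apply: upper => S; exact: le_trans (ler_norm _) (cM S).
rewrite -sumrN; under eq_bigr do rewrite -mulrN.
apply: upper => S; rewrite sumrN; apply: le_trans (ler_norm _) _.
by rewrite normrN.
Qed.

(** A bilinear form is maximal at a pair of vertices: freeze one argument and
maximize the linear form in the other, twice. *)
Lemma weighted_rectangle_sum_le (R : realType) (I J : finType)
    (a : I -> R) (b : J -> R) (g : I * J -> R) (h M : R) :
  0 <= h -> (forall i, 0 <= a i <= h) -> (forall j, 0 <= b j <= h) ->
  (forall (S : {set I}) (T : {set J}),
    `|\sum_(ij in finset.setX S T) g ij| <= M) ->
  `|\sum_ij a ij.1 * b ij.2 * g ij| <= h ^+ 2 * M.
Proof.
move=> h0 ah bh gM.
have -> : \sum_ij a ij.1 * b ij.2 * g ij = \sum_i a i * \sum_j b j * g (i, j).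
  rewrite (eq_bigr (fun ij => a ij.1 * b ij.2 * g (ij.1, ij.2))); last first.
    by move=> [].
  rewrite -(pair_bigA _ (fun i j => a i * b j * g (i, j)))/=.
  apply: eq_bigr => i _; rewrite mulr_sumr.
  by apply: eq_bigr => j _; rewrite mulrA.
(* Vertices for a first, with b fixed; then vertices for b. *)
rewrite expr2 -mulrA; apply: weighted_sum_le => // S.
have -> : \sum_(i in S) \sum_j b j * g (i, j) =
    \sum_j b j * \sum_(i in S) g (i, j).
  by rewrite exchange_big/=; apply: eq_bigr => j _; rewrite mulr_sumr.
apply: weighted_sum_le => // T; rewrite exchange_big/=.
apply: le_trans (gM S T); rewrite pair_big/= le_eqVlt.
apply/orP; left; apply/eqP.
by congr (`| _ |); apply: eq_big => [[i j]|[i j] _//]; rewrite finset.in_setX.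
Qed.

Section step_kernels.
Context (R : realType) (N : nat).
Hypothesis N_gt0 : (0 < N)%N.

Let NR0 : 0 < N%:R :> R. Proof. by rewrite ltr0n. Qed.

Definition cell (i : nat) : set R := `[i%:R / N%:R, i.+1%:R / N%:R[%classic.

Lemma measurable_cell i : measurable (cell i).
Proof. exact: measurable_itv. Qed.

Lemma lebesgue_measure_cell i : lebesgue_measure (cell i) = (N%:R^-1)%:E.
Proof.
rewrite lebesgue_measure_itv/= lte_fin ltr_pM2r ?invr_gt0// ltr_nat ltnSn.
by rewrite -EFinB -mulrBl -natrB// subSnn mul1r.
Qed.

Lemma cell_truncn (u : R) i : 0 <= u ->
  cell i u <-> Num.truncn (N%:R * u + 1) = i.+1.
Proof.
move=> u0; have Nu0 : 0 <= N%:R * u by rewrite mulr_ge0 ?ler0n.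
have -> : Num.truncn (N%:R * u + 1) = (Num.truncn (N%:R * u)).+1.
  apply: truncn_def; have := truncn_itv Nu0; rewrite !mulrSr; lra.
rewrite /cell/= in_itv/= ler_pdivrMr// ltr_pdivlMr// ![u * _]mulrC.
by split=> [/truncn_def -> //|[<-]]; exact: truncn_itv.
Qed.

(** The half-open cells tile [0, 1), so exactly one term survives there, and
none outside. *)
Lemma step_kernelE (G : nat -> nat -> R) (p : R * R) :
  step_kernel N G p =
  \sum_(ij : 'I_N * 'I_N) G ij.1.+1 ij.2.+1 * \1_(cell ij.1 `*` cell ij.2) p.
Proof.
case: p => u v; rewrite /step_kernel/=.
have cellP (z : R) i : (z \in `[0, 1[) -> (\1_(cell i) z : R) =
    (Num.truncn (N%:R * z + 1) == i.+1)%:R.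
  move=> /=; rewrite in_itv/= => /andP[z0 _].
  rewrite indicE; congr ((nat_of_bool _)%:R).
  apply/idP/eqP => [/set_mem|] h; last apply/mem_set; exact/(cell_truncn _ z0).
have trunc_ord (z : R) : (z \in `[0, 1[) ->
    {i : 'I_N | Num.truncn (N%:R * z + 1) = i.+1}.
  rewrite in_itv/= => /andP[z0 z1].
  have Nz0 : 0 <= N%:R * z by rewrite mulr_ge0 ?ler0n.
  have lt_i : (Num.truncn (N%:R * z) < N)%N.
    by rewrite truncn_lt_nat// gtr_pMr.
  exists (Ordinal lt_i); apply: truncn_def => /=.
  have := truncn_itv Nz0; rewrite !mulrSr; lra.
have cell_out (z : R) (i : 'I_N) : (z \in `[0, 1[) = false ->
    (\1_(cell i) z : R) = 0.
  move=> zn; rewrite indicE memNset// /cell/= in_itv/= => /andP[iz zi].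
  move: zn; rewrite in_itv/= (le_trans _ iz) ?divr_ge0 ?ler0n//=.
  rewrite (lt_le_trans zi)// ler_pdivrMr// mul1r ler_nat; exact: ltn_ord.
have indicX (ij : 'I_N * 'I_N) : (\1_(cell ij.1 `*` cell ij.2) (u, v) : R) =
    \1_(cell ij.1) u * \1_(cell ij.2) v.
  by rewrite !indicE in_setX -natrM mulnb.
under eq_bigr do rewrite indicX.
case: ifPn => [/andP[uI vI]|/nandP uv]; last first.
  rewrite big1// => ij _; case: uv => /negbTE out.
    by rewrite (cell_out u)// mul0r mulr0.
  by rewrite (cell_out v)// !mulr0.
have [i0 ui] := trunc_ord u uI; have [j0 vj] := trunc_ord v vI.
rewrite (bigD1 (i0, j0))//= big1 ?addr0.
  by rewrite !cellP// ui vj !eqxx !mulr1.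
move=> [i j] /= ij; rewrite !cellP// ui vj !eqSS -natrM mulnb.
by rewrite !(inj_eq val_inj) -xpair_eqE/= eq_sym (negbTE ij) mulr0.
Qed.

Lemma measurable_step_kernel G :
  measurable_fun setT (step_kernel N G : R * R -> R).
Proof.
rewrite (_ : step_kernel N G = fun p => \sum_(ij : 'I_N * 'I_N)
  G ij.1.+1 ij.2.+1 * \1_(cell ij.1 `*` cell ij.2) p); last first.
  by apply/funext => p; exact: step_kernelE.
apply: measurable_sum => ij; apply: measurable_funM => //.
by apply: measurable_indic; apply: measurableX; exact: measurable_cell.
Qed.

Let cell_fin (U : set R) i : measurable U ->
  lebesgue_measure (cell i `&` U) \is a fin_num.
Proof.
move=> mU; rewrite ge0_fin_numE//.
apply: (@le_lt_trans _ _ (lebesgue_measure (cell i))).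
  by apply: le_measure; rewrite ?inE//; [apply: measurableI => //|];
    exact: measurable_cell.
by rewrite lebesgue_measure_cell ltry.
Qed.

Let integrable_cell (S T : set R) i j : measurable S -> measurable T ->
  (lebesgue_measure \x lebesgue_measure)%E.-integrable (S `*` T)
    (fun p => (\1_(cell i `*` cell j) p)%:E).
Proof.
move=> mS mT; have mC : measurable (cell i `*` cell j).
  by apply: measurableX; exact: measurable_cell.
have mST : measurable (S `*` T) by exact: measurableX.
apply/integrableP; split.
  by apply/measurable_EFinP; exact: measurable_indic.
under eq_integral do rewrite gee0_abs ?lee_fin//.
rewrite integral_indic// -setXI [ltLHS]product_measure1E; last 2 first.
- by apply: measurableI => //; exact: measurable_cell.
- by apply: measurableI => //; exact: measurable_cell.
by rewrite ltey_eq fin_numM// cell_fin.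
Qed.

Lemma integrable_step_kernel (G : nat -> nat -> R) (S T : set R) :
  measurable S -> measurable T ->
  (lebesgue_measure \x lebesgue_measure)%E.-integrable (S `*` T)
    (EFin \o step_kernel N G).
Proof.
move=> mS mT; have mST : measurable (S `*` T) by exact: measurableX.
have -> : EFin \o step_kernel N G = fun p => (\sum_(ij : 'I_N * 'I_N)
    (G ij.1.+1 ij.2.+1)%:E * (\1_(cell ij.1 `*` cell ij.2) p)%:E)%E.
  apply/funext => p /=; rewrite step_kernelE -sumEFin.
  by apply: eq_bigr => ij _; rewrite EFinM.
apply: integrable_sum => // ij _.
by apply: integrableZl => //; exact: integrable_cell.
Qed.

Lemma integral_step_kernel (G : nat -> nat -> R) (S T : set R) :
  measurable S -> measurable T ->
  (\int[lebesgue_measure \x lebesgue_measure]_(p in S `*` T)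
     (step_kernel N G p)%:E =
  (\sum_(ij : 'I_N * 'I_N) fine (lebesgue_measure (cell ij.1 `&` S)) *
    fine (lebesgue_measure (cell ij.2 `&` T)) * G ij.1.+1 ij.2.+1)%:E)%E.
Proof.
move=> mS mT; have mST : measurable (S `*` T) by exact: measurableX.
under eq_integral do rewrite step_kernelE -sumEFin.
rewrite integral_sum//.
- rewrite -sumEFin; apply: eq_bigr => ij _.
  under eq_integral do rewrite EFinM.
  rewrite integralZl//; last exact: integrable_cell.
  rewrite integral_indic//; last first.
    by apply: measurableX; exact: measurable_cell.
  rewrite -setXI [X in (_ * X)%E]product_measure1E; last 2 first.
  + by apply: measurableI => //; exact: measurable_cell.
  + by apply: measurableI => //; exact: measurable_cell.
  by rewrite muleC !EFinM !fineK ?cell_fin.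
- move=> ij; under eq_fun do rewrite EFinM.
  by apply: integrableZl => //; exact: integrable_cell.
Qed.

(** The cells have mass 1/N, so the extreme value of the bilinear form is 1/N^2
times a rectangle sum, for arbitrary measurable S and T. *)
Lemma integral_step_kernel_le (G : nat -> nat -> R) (M : R) (S T : set R) :
  measurable S -> measurable T ->
  (forall A B : {set 'I_N},
    `|\sum_(ij in finset.setX A B) G ij.1.+1 ij.2.+1| <= M * N%:R ^+ 2) ->
  (`|\int[lebesgue_measure \x lebesgue_measure]_(p in S `*` T)
     (step_kernel N G p)%:E| <= M%:E)%E.
Proof.
move=> mS mT GM; rewrite integral_step_kernel// lee_fin.
have fineP (U : set R) i : measurable U ->
    0 <= fine (lebesgue_measure (cell i `&` U)) <= N%:R^-1.
  move=> mU; rewrite fine_ge0//= -lee_fin fineK ?cell_fin//.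
  rewrite -(lebesgue_measure_cell i).
  by apply: le_measure; rewrite ?inE//; [apply: measurableI => //|];
    exact: measurable_cell.
have := @weighted_rectangle_sum_le R _ _
  (fun i : 'I_N => fine (lebesgue_measure (cell i `&` S)))
  (fun j : 'I_N => fine (lebesgue_measure (cell j `&` T)))
  (fun ij => G ij.1.+1 ij.2.+1) N%:R^-1 (M * N%:R ^+ 2).
rewrite invr_ge0 ler0n.
move=> /(_ isT (fun i => fineP S i mS) (fun i => fineP T i mT) GM).
by rewrite mulrCA -exprMn mulVf ?gt_eqF// expr1n mulr1.
Qed.
End step_kernels.

(** * Almost every point of the square is regular *)

(** An open set is the union of the boxes with rational centre and radius
1/(n+1) that it contains, and these are countably many. *)
Lemma open_measurable_prod (R : realType) (U : set (R * R)) :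
  open U -> measurable U.
Proof.
move=> oU; pose box (abn : rat * rat * nat) : set (R * R) :=
  ball (ratr abn.1.1 : R) (abn.2.+1%:R^-1 : R) `*`
  ball (ratr abn.1.2 : R) (abn.2.+1%:R^-1 : R).
have -> : U = \bigcup_abn (if `[< box abn `<=` U >] then box abn else set0).
  apply/seteqP; split => [p Up|p [abn _]]; last first.
    by case: asboolP => // + ?; apply.
  have /nbhs_ballP[e /= e0 peU] := open_nbhs_nbhs (conj oU Up).
  have [n] := ltr_add_invr (divr_gt0 e0 (ltr0n R 2)); rewrite add0r => ne.
  have n0 : 0 < n.+1%:R^-1 :> R by [].
  have close (x : R) : exists a : rat, ball x n.+1%:R^-1 (ratr a).
    have [y [xy [a _ ay]]] :=
      dense_rat (ex_intro _ x (ballxx x n0)) (ball_open x _).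
    by exists a; rewrite ay.
  have [a pa] := close p.1; have [b pb] := close p.2.
  exists (a, b, n) => //; rewrite (asboolT _)/=.
    by split => /=; exact: ball_sym.
  have le_e : n.+1%:R^-1 + n.+1%:R^-1 <= e by rewrite [leRHS]splitr lerD// ltW.
  move=> q [/= aq bq]; apply: peU; split => /=.
    exact: le_ball le_e _ (ball_triangle pa aq).
  exact: le_ball le_e _ (ball_triangle pb bq).
apply: countable_bigcupT_measurable => // abn; case: asboolP => // _.
by apply: measurableX; apply: measurable_ball.
Qed.

Lemma measurable_unit_square (R : realType) : measurable (unit_square R).
Proof. by apply: measurableX; exact: measurable_itv. Qed.

(** The entourages of [subspace A] only constrain pairs of points of [A], so
this is continuity along [A] and not in the plane. *)
Lemma unif_continuous_within (U V : uniformType) (f : U -> V) (A : set U) p :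
  unif_continuous (f : subspace A -> V) -> A p ->
  f q @[q --> within A (nbhs p)] --> f p.
Proof.
move=> f_unif Ap; apply/cvg_app_entourageP => E entE.
have [W entW WE] := f_unif E entE.
have := nbhs_entourage p entW.
apply: filterS => q /xsectionP Wpq Aq.
by apply: (WE (p, q)); right.
Qed.

Lemma open_subspace_within (T : topologicalType) (D A : set T) (p : T) :
  open (A : set (subspace D)) -> D p -> A p ->
  \forall q \near within D (nbhs p), A q.
Proof.
move=> /open_subspaceP[V oV VDA] Dp Ap.
have Vp : V p by have [] : (V `&` D) p by rewrite VDA.
have := open_nbhs_nbhs (conj oV Vp); apply: filterS => q Vq Dq.
by have [] : (A `&` D) q by rewrite -VDA.
Qed.

(** For every n, each vertical section of the remainder is contained in one of
measure at most 1/(n+1); Fubini's theorem integrates null sections to 0. *)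
Lemma regular_points_full_measure (R : realType) (A : nat -> set (R * R)) :
  (forall n, A n `<=` unit_square R) ->
  (forall n, open (A n : set (subspace (unit_square R)))) ->
  (forall n u, u \in `[0, 1] ->
    (lebesgue_measure (`[0%R, 1%R]%classic `\` [set v | A n (u, v)])
       <= (n.+1%:R^-1)%:E)%E) ->
  (lebesgue_measure \x lebesgue_measure)%E.-negligible
    (unit_square R `\` \bigcup_n A n).
Proof.
move=> A_sub A_open A_small.
have mA n : measurable (A n).
  have /open_subspaceP[V oV VA] := A_open n.
  rewrite -(setIidl (A_sub n)) -VA; apply: measurableI.
    exact: open_measurable_prod.
  exact: measurable_unit_square.
have mD : measurable (unit_square R `\` \bigcup_n A n).
  apply: measurableD; first exact: measurable_unit_square.
  exact: bigcupT_measurable.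
exists (unit_square R `\` \bigcup_n A n); split => //.
rewrite /= /product_measure1; apply: integral0_eq => u _ /=.
have [u01|u01] := pselect (u \in `[0, 1]); last first.
  rewrite (_ : xsection _ _ = set0) ?measure0//.
  by rewrite -subset0 => v /xsectionP[[]].
apply/eqP; rewrite eq_le measure_ge0 andbT; apply/lee_addgt0Pr => e e0.
have [n] := ltr_add_invr e0; rewrite !add0r => /ltW ne.
apply: le_trans (_ : (n.+1%:R^-1)%:E <= _)%E; last by rewrite lee_fin.
apply: le_trans (A_small n u u01).
have -> : `[0%R, 1%R]%classic `\` [set v | A n (u, v)] =
    xsection (unit_square R `\` A n) u.
  by apply/seteqP; split => v => [[v01 nA]|/xsectionP[[_ v01] nA]] //;
    apply/xsectionP.
apply: le_measure.
- by rewrite inE; exact: measurable_xsection.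
- rewrite inE; apply: measurable_xsection; apply: measurableD.
    exact: measurable_unit_square.
  exact: mA.
- move=> v /xsectionP[p01 nA]; apply/xsectionP.
  by split => // An; apply: nA; exists n.
Qed.

(** * The discretization error tends to 0 in L1 *)

Definition grid_sample (R : realType) (K : R * R -> R) (N i j : nat) : R :=
  K (i%:R / N%:R, j%:R / N%:R).

(** The node used at [u] is the right endpoint of the cell of [u]. *)
Lemma truncn_grid_itv (R : realType) (N : nat) (u : R) :
  (0 < N)%N -> u \in `[0, 1[ ->
  (1 <= Num.truncn (N%:R * u + 1) <= N)%N /\
  u <= (Num.truncn (N%:R * u + 1))%:R / N%:R <= u + N%:R^-1.
Proof.
move=> N0; rewrite in_itv/= => /andP[u0 u1].
have NR0 : 0 < N%:R :> R by rewrite ltr0n.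
have Nu0 : 0 <= N%:R * u by rewrite mulr_ge0.
have Nu1 : 0 <= N%:R * u + 1 by rewrite addr_ge0.
split.
  rewrite truncn_gt0 lerDr Nu0/= -ltnS truncn_lt_nat// -natr1 ltrD2r.
  by rewrite gtr_pMr.
have /andP[t1 t2] := truncn_itv Nu1; rewrite -natr1 ltrD2r in t2.
rewrite ler_pdivlMr// ler_pdivrMr// mulrDl mulVf ?gt_eqF// !(mulrC u).
by rewrite t1 ltW.
Qed.

Lemma cvg_truncn_grid (R : realType) (u : R) : u \in `[0, 1[ ->
  (Num.truncn (N%:R * u + 1))%:R / N%:R @[N --> \oo] --> u.
Proof.
move=> u01.
apply: (@squeeze_cvgr _ _ _ _ (fun=> u) (fun N => u + N%:R^-1)).
- near=> N; have N0 : (0 < N)%N by near: N; exact: nbhs_infty_gt.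
  by have [] := truncn_grid_itv N0 u01.
- exact: cvg_cst.
- rewrite -[X in _ --> X]addr0; apply: cvgD; first exact: cvg_cst.
  apply/gtr0_cvgV0; last exact: cvgr_idn.
  by near=> N; rewrite ltr0n; near: N; exact: nbhs_infty_gt.
Unshelve. all: by end_near. Qed.

Lemma grid_unit_square (R : realType) (N i j : nat) :
  (1 <= i <= N)%N -> (1 <= j <= N)%N ->
  unit_square R (i%:R / N%:R, j%:R / N%:R).
Proof.
move=> /andP[i1 iN] /andP[j1 jN].
have N0 : 0 < N%:R :> R by rewrite ltr0n (leq_trans i1).
by split; rewrite /= in_itv/= divr_ge0//= ler_pdivrMr// mul1r ler_nat.
Qed.

(** The nodes lie in the square and tend to [p], so they eventually enter [A],
which is open in the square; continuity along [A] then applies. *)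
Lemma cvg_step_kernel_grid_sample (R : realType) (K : R * R -> R)
    (A : set (R * R)) (p : R * R) :
  open (A : set (subspace (unit_square R))) ->
  unif_continuous (K : subspace A -> R) ->
  p.1 \in `[0, 1[ -> p.2 \in `[0, 1[ -> A p ->
  step_kernel N (grid_sample K N) p @[N --> \oo] --> K p.
Proof.
move=> A_open K_unif p1 p2 Ap.
pose q N : R * R := ((Num.truncn (N%:R * p.1 + 1))%:R / N%:R,
                     (Num.truncn (N%:R * p.2 + 1))%:R / N%:R).
have -> : (fun N => step_kernel N (grid_sample K N) p) = K \o q.
  by apply/funext => N; rewrite /step_kernel p1 p2.
have qp : q N @[N --> \oo] --> p.
  exact: cvg_pair (cvg_truncn_grid p1) (cvg_truncn_grid p2).
have sq_p : unit_square R p.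
  by split; [move: p1|move: p2]; rewrite /= !in_itv/= => /andP[-> /ltW].
have q_sq : \forall N \near \oo, unit_square R (q N).
  near=> N; have N0 : (0 < N)%N by near: N; exact: nbhs_infty_gt.
  by apply: grid_unit_square; have [] := truncn_grid_itv N0 p1;
    have [] := truncn_grid_itv N0 p2.
have q_A : \forall N \near \oo, A (q N).
  have := qp _ (open_subspace_within A_open sq_p Ap).
  by apply: filterS2 q_sq => N sq_q; apply.
apply: (@cvg_comp _ _ _ q K _ (within A (nbhs p))) => [B AB|].
  by have := qp _ AB; apply: filterS2 q_A => N ? /=; apply.
exact: unif_continuous_within.
Unshelve. all: by end_near. Qed.

Lemma step_kernel_grid_sample_range (R : realType) (K : R * R -> R) N p :
  (forall p, unit_square R p -> 0 <= K p <= 1) -> (0 < N)%N ->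
  0 <= step_kernel N (grid_sample K N) p <= 1.
Proof.
move=> K01 N0; rewrite /step_kernel; case: ifPn => [/andP[p1 p2]|_]; last first.
  by rewrite lexx ler01.
by apply: K01; apply: grid_unit_square; have [] := truncn_grid_itv N0 p1;
    have [] := truncn_grid_itv N0 p2.
Qed.

Lemma integral_step_kernel_grid_sample (R : realType) (K : R * R -> R) :
  measurable_fun (unit_square R) K ->
  (forall p, unit_square R p -> 0 <= K p <= 1) ->
  unif_continuous_off_small_sections K ->
  (\int[lebesgue_measure \x lebesgue_measure]_(p in unit_square R)
    `|(step_kernel N (grid_sample K N) p - K p)%:E| @[N --> \oo] --> 0)%E.
Proof.
move=> mK K01 K_reg.
have /choice[A AP] : forall n : nat, exists A : set (R * R),
    [/\ A `<=` unit_square R, open (A : set (subspace (unit_square R))),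
        unif_continuous (K : subspace A -> R) &
        forall u : R, u \in `[0, 1] ->
          (lebesgue_measure (`[0%R, 1%R]%classic `\` [set v | A (u, v)])
             <= (n.+1%:R^-1)%:E)%E].
  by move=> n; apply: K_reg; rewrite invr_gt0.
(* Step kernels vanish on the edges u = 1 and v = 1, where K need not. *)
pose border : set (R * R) := ([set 1] `*` setT) `|` (setT `*` [set 1]).
have border0 : (lebesgue_measure \x lebesgue_measure)%E.-negligible border.
  apply: negligibleU; apply/negligibleP.
  - by apply: measurableX.
  - rewrite [LHS]product_measure1E//.
    by rewrite [X in (X * _)%E]lebesgue_measure_set1 mul0e.
  - by apply: measurableX.
  - rewrite [LHS]product_measure1E//.
    by rewrite [X in (_ * X)%E]lebesgue_measure_set1 mule0.
have irregular0 : (lebesgue_measure \x lebesgue_measure)%E.-negligible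
    (unit_square R `\` \bigcup_n A n).
  by apply: regular_points_full_measure => n; have [] := AP n.
have mf N : measurable_fun (unit_square R)
    (fun p => (step_kernel N.+1 (grid_sample K N.+1) p - K p)%:E).
  apply/measurable_EFinP; apply: measurable_funB => //.
  by apply: measurable_funTS; exact: measurable_step_kernel.
have cvg_ae : {ae (lebesgue_measure \x lebesgue_measure)%E, forall p,
    unit_square R p ->
    (step_kernel N.+1 (grid_sample K N.+1) p - K p)%:E @[N --> \oo] --> 0%E}.
  apply: negligibleS (negligibleU border0 irregular0) => p /=.
  move=> /not_implyP[sqp]; apply: contra_notP => /not_orP[nb].
  move=> /not_andP[//|/contrapT[n _ Anp]].
  have [_ An_open K_unif _] := AP n.
  have lt1 (z : R) : z \in `[0, 1] -> z <> 1 -> z \in `[0, 1[.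
    rewrite !in_itv/= => /andP[-> z1] /eqP nz1.
    by rewrite lt_neqAle nz1.
  have p1 : p.1 \in `[0, 1[.
    by apply: lt1; [case: sqp|move=> p1; apply: nb; left].
  have p2 : p.2 \in `[0, 1[.
    by apply: lt1; [case: sqp|move=> p2; apply: nb; right].
  apply/fine_cvgP; split; first exact: nearW.
  rewrite -(subrr (K p)); apply: cvgB; last exact: cvg_cst.
  rewrite (cvg_shiftS (fun N => step_kernel N (grid_sample K N) p)).
  exact: cvg_step_kernel_grid_sample An_open K_unif p1 p2 Anp.
have int1 : (lebesgue_measure \x lebesgue_measure)%E.-integrable
    (unit_square R) (EFin \o cst 1).
  apply: measurable_bounded_integrable => //.
  - exact: measurable_unit_square.
  - rewrite [ltLHS]product_measure1E//= lebesgue_measure_itv/=.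
    by rewrite lte_fin ltr01 -EFinB subr0 mule1 ltry.
  - exact: bounded_cst.
(* Dropping N = 0, for which the grid is empty. *)
rewrite -cvg_shiftS.
have [] := @dominated_convergence _ _ R (lebesgue_measure \x lebesgue_measure)%E
  _ (@measurable_unit_square R) _ (cst 0%E) _ mf (measurable_cst _) cvg_ae int1.
  apply: aeW => p N sqp; rewrite lee_fin ler_norml/=.
  have /andP[? ?] := step_kernel_grid_sample_range p K01 (ltn0Sn N).
  have /andP[? ?] := K01 p sqp; lra.
by move=> _ + _; under eq_fun do under eq_integral do rewrite sube0.
Qed.

(** * The cut norm of the error *)

(** Noise plus bias: over a rectangle S x T the step kernel of the centred array
is bounded by its rectangle sums, and the rest by the full L1 norm. *)
Lemma cut_norm_step_kernel_le (R : realType) (K : R * R -> R) (N : nat)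
    (G : nat -> nat -> R) (M : R) :
  measurable_fun (unit_square R) K ->
  (forall p, unit_square R p -> 0 <= K p <= 1) ->
  (0 < N)%N ->
  (forall S T : {set 'I_N},
    `|\sum_(ij in finset.setX S T)
        (G ij.1.+1 ij.2.+1 - grid_sample K N ij.1.+1 ij.2.+1)| <=
    M * N%:R ^+ 2) ->
  (cut_norm (fun p => (step_kernel N G p - K p)%R) <=
  M%:E + \int[lebesgue_measure \x lebesgue_measure]_(p in unit_square R)
    `|(step_kernel N (grid_sample K N) p - K p)%R%:E|)%E.
Proof.
move=> mK K01 N0 GM; apply: ge_ereal_sup => _ [S [T [mS mT S01 T01 ->]]].
have mST : measurable (S `*` T) by exact: measurableX.
have ST01 : S `*` T `<=` unit_square R.
  by move=> p [Sp Tp]; split; [exact: S01|exact: T01].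
pose noise i j : R := G i j - grid_sample K N i j.
pose bias (p : R * R) : R := step_kernel N (grid_sample K N) p - K p.
have mbias : measurable_fun (unit_square R) bias.
  apply: measurable_funB => //.
  by apply: measurable_funTS; exact: measurable_step_kernel.
have finite01 (U : set R) : measurable U -> U `<=` `[0, 1] ->
    (lebesgue_measure U < +oo)%E.
  move=> mU U01.
  apply: (@le_lt_trans _ _ (lebesgue_measure `[0%R, 1%R]%classic)).
    by apply: le_measure; rewrite ?inE//; exact: measurable_itv.
  by rewrite lebesgue_measure_itv/= lte_fin ltr01 ltry.
have ibias : (lebesgue_measure \x lebesgue_measure)%E.-integrable
    (S `*` T) (EFin \o bias).
  apply: measurable_bounded_integrable => //.
  - rewrite [ltLHS]product_measure1E//.
    by apply: lte_mul_pinfty => //; [rewrite ge0_fin_numE//|]; apply: finite01.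
  - by apply: measurable_funS mbias => //; exact: measurable_unit_square.
  - exists 1; split => // m m1 p /ST01 sqp /=; apply: le_trans (ltW m1).
    have /andP[? ?] := step_kernel_grid_sample_range p K01 N0.
    by have /andP[? ?] := K01 p sqp; rewrite ler_norml /bias; lra.
have -> : (\int[lebesgue_measure \x lebesgue_measure]_(p in S `*` T)
      ((step_kernel N G p - K p)%R%:E) =
    \int[lebesgue_measure \x lebesgue_measure]_(p in S `*` T)
      ((step_kernel N noise p)%:E + (bias p)%:E))%E.
  apply: eq_integral => p _; rewrite -EFinD; congr (_%:E).
  rewrite /bias /noise /step_kernel addrA.
  by case: ifP => _; [rewrite subrK|rewrite addr0].
rewrite integralD//; last exact: integrable_step_kernel.
apply: le_trans (lee_abs_add _ _) _; apply: leeD.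
  exact: integral_step_kernel_le.
apply: le_trans (le_abse_integral _ _ _) _ => //.
  apply/measurable_EFinP; apply: measurable_funS mbias => //.
  exact: measurable_unit_square.
apply: ge0_subset_integral => //.
  exact: measurable_unit_square.
by do 2 apply: measurableT_comp => //.
Qed.

Unset Implicit Arguments.

Theorem proposition12 (R : realType) (d : measure_display)
    (Omega : measurableType d) (P : probability Omega R)
    (K : R * R -> R)
    (K_measurable : measurable_fun (unit_square R) K)
    (K_range : forall p, unit_square R p -> 0 <= K p <= 1)
    (K_regular : unif_continuous_off_small_sections K)
    (KN : forall N i j : nat, {RV P >-> R})
    (KN_law : forall N i j : nat,
      (1 <= i <= N)%N -> (1 <= j <= N)%N ->
      forall B : set R, measurable B ->
        distribution P (KN N i j) B =
        bernoulli_law (K (i%:R / N%:R, j%:R / N%:R)) B)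
    (KN_independent : forall N : nat, (1 <= N)%N ->
      mutually_independent
        (fun ij : 'I_N * 'I_N => KN N ij.1.+1 ij.2.+1)) :
  {ae P, forall w : Omega,
    cut_norm (fun p => step_kernel N (fun i j => KN N i j w) p - K p)
      @[N --> \oo] --> 0%E}.
Proof.
have p01 N (ij : 'I_N * 'I_N) : 0 <= grid_sample K N ij.1.+1 ij.2.+1 <= 1.
  by apply: K_range; apply: grid_unit_square; exact: ltn_ord.
have X_law N (ij : 'I_N * 'I_N) (B : set R) : measurable B ->
    distribution P (KN N ij.1.+1 ij.2.+1) B =
    bernoulli_law (grid_sample K N ij.1.+1 ij.2.+1) B.
  by apply: KN_law; exact: ltn_ord.
have X_indep N : mutually_independent
    (fun ij : 'I_N * 'I_N => KN N ij.1.+1 ij.2.+1).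
  (* An empty family is independent. *)
  have [N0|] := posnP N; last exact: KN_independent.
  move=> J B _.
  have J0 (ij : 'I_N * 'I_N) : (ij \in J) = false.
    by case: ij => -[i iN]; exfalso; move: iN; rewrite N0.
  rewrite big_pred0// (_ : \bigcap_(i in _) _ = setT) ?probability_setT//.
  by apply/seteqP; split => // w _ ij /=; rewrite J0.
have := ae_small_rectangle_sums p01 X_law X_indep.
apply: filterS => w small.
apply: (@squeeze_cvge _ _ _ _ (cst 0%E) _ (fun N => (deviation_rate R N)%:E +
  \int[lebesgue_measure \x lebesgue_measure]_(p in unit_square R)
    `|(step_kernel N (grid_sample K N) p - K p)%R%:E|)%E).
- near=> N; apply/andP; split.
    apply: ereal_sup_ubound; exists set0, set0; split => //.
    by rewrite set0X integral_set0 abse0.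
  apply: cut_norm_step_kernel_le => //; last by near: N.
  by near: N; exact: nbhs_infty_gt.
- exact: cvg_cst.
- rewrite -[X in _ --> X]adde0; apply: cvgeD => //.
    by apply/fine_cvgP; split; [exact: nearW|exact: cvg_deviation_rate].
  exact: integral_step_kernel_grid_sample.
Unshelve. all: by end_near. Qed.
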